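(* Let $\mathfrak A$ be a first-order structure with universe $A$ and let $N$ be a natural number. Then $\mathfrak{Cs}_N(\mathfrak A)\cong\mathfrak{Cs}_{\mathrm{IFG}_{N,\emptyset}}(\mathfrak A)$, i.e. the two algebras are isomorphic, where the operations $0,1,D_{ij},-,+,\cdot,C_n$ of $\mathfrak{Cs}_N(\mathfrak A)$ correspond respectively to the operations $0,1,D_{ij},{}^{\cup},+_\emptyset,\cdot_\emptyset,C_{n,\emptyset}$ of $\mathfrak{Cs}_{\mathrm{IFG}_{N,\emptyset}}(\mathfrak A)$ ($i,j,n<N$).
   Context: ${}^N\!A$ is the set of $N$-tuples $\vec a=(a_0,\dots,a_{N-1})$ (valuations of $v_0,\dots,v_{N-1}$) of elements of $A$; $\mathscr P$ denotes power set. $\vec a(n:b)$ is $\vec a$ with $n$-th coordinate replaced by $b$; for $V\subseteq{}^N\!A$ and $f\colon V\to A$, $V(n:f)=\{\vec a(n:f(\vec a))\mid\vec a\in V\}$ and $V(n:A)=\{\vec a(n:b)\mid\vec a\in V,b\in A\}$. The $N$-dimensional cylindric set algebra over $\mathfrak A$, $\mathfrak{Cs}_N(\mathfrak A)$, has as universe the set of all $\phi^{\mathfrak A}=\{\vec a\in{}^N\!A\mid\mathfrak A\models\phi[\vec a]\}$ where $\phi$ ranges over the first-order formulas in the language of $\mathfrak A$ using only the variables $v_0,\dots,v_{N-1}$; its operations are $0=\emptyset$, $1={}^N\!A$, $D_{ij}=\{\vec a\in{}^N\!A\mid a_i=a_j\}$, $-V={}^N\!A\setminus V$, $V+W=V\cup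 W$, $V\cdot W=V\cap W$, $C_n(V)=V(n:A)$, for $i,j,n<N$. On pairs $X=\langle X^+,X^-\rangle\in\mathscr P(\mathscr P({}^N\!A))\times\mathscr P(\mathscr P({}^N\!A))$ consider the operations: - $0=\langle\{\emptyset\},\mathscr P({}^N\!A)\rangle$, $1=\langle\mathscr P({}^N\!A),\{\emptyset\}\rangle$; - $D_{ij}=\langle\mathscr P(\{\vec a\mid a_i=a_j\}),\mathscr P(\{\vec a\mid a_i\neq a_j\})\rangle$ for $i,j<N$; - $X^{\cup}=\langle X^-,X^+\rangle$; - $X+_\emptyset Y$: $V\in(X+_\emptyset Y)^+$ iff $V=V_1\cup V_2$ for some disjoint $V_1\in X^+,V_2\in Y^+$; $(X+_\emptyset Y)^-=X^-\cap Y^-$; - $X\cdot_\emptyset Y$: $(X\cdot_\emptyset Y)^+=X^+\cap Y^+$; $W\in(X\cdot_\emptyset Y)^-$ iff $W=W_1\cup W_2$ for some disjoint $W_1\in X^-,W_2\in Y^-$; - $C_{n,\emptyset}(X)$ for $n<N$: $V\in C_{n,\emptyset}(X)^+$ iff $V(n:f)\in X^+$ for some function $f\colon V\to A$; $W\in C_{n,\emptyset}(X)^-$ iff $W(n:A)\in X^-$. The meaning in $\mathfrak A$ of an atomic first-order formula $\phi$ with variables among $v_0,\dots,v_{N-1}$ is $\|\phi\|_{\mathfrak A}=\langle\|\phi\|^+,\|\phi\|^-\rangle$, where $V\in\|\phi\|^+$ iff $\mathfrak A\models\phi[\vec a]$ for every $\vec a\in V$, and $W\in\|\phi\|^-$ iff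 $\mathfrak A\not\models\phi[\vec b]$ for every $\vec b\in W$. $\mathfrak{Cs}_{\mathrm{IFG}_{N,\emptyset}}(\mathfrak A)$ is the algebra in the signature $\langle0,1,D_{ij},{}^{\cup},+_\emptyset,\cdot_\emptyset,C_{n,\emptyset}\rangle$ ($i,j,n<N$) generated, under these operations, by the meanings in $\mathfrak A$ of all such atomic formulas in the language of $\mathfrak A$. (It is a subalgebra of the reduct to this signature of the $\mathrm{IFG}_N$-cylindric set algebra $\mathfrak{Cs}_{\mathrm{IFG}_N}(\mathfrak A)$ of meanings of all $\mathrm{IFG}_N$-formulas.) *)

(* Defs.v *)
From mathcomp Require Import all_boot.
From mathcomp Require Import boolp classical_sets.

Set Implicit Arguments.
Unset Strict Implicit.
Unset Printing Implicit Defensive.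

Local Open Scope classical_set_scope.

Record language := Language {
  fsym : Type;
  far : fsym -> nat;
  rsym : Type;
  rar : rsym -> nat
}.

Record structure (L : language) := Structure {
  univ :> Type;
  fint : forall f : fsym L, {ffun 'I_(far f) -> univ} -> univ;
  rint : forall r : rsym L, set {ffun 'I_(rar r) -> univ}
}.

Section Syntax.
Variables (L : language) (N : nat).

Inductive term :=
| Var of 'I_N
| App (f : fsym L) of ('I_(far f) -> term).

Inductive atom :=
| Eq of term & term
| Rel (r : rsym L) of ('I_(rar r) -> term).

(* The connectives Top and Bot matter only for N = 0: without them there might
   be no formula at all, and then no algebra of formula meanings. *)
Inductive formula :=
| Atom of atom
| Top
| Bot
| Not of formula
| And of formula & formula
| Or of formula & formula
| Imp of formula & formula
| Exists of 'I_N & formula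
| Forall of 'I_N & formula.

End Syntax.

Arguments Top {L N}.
Arguments Bot {L N}.

Definition upd (A : Type) (N : nat) (a : {ffun 'I_N -> A}) (n : 'I_N) (b : A) :
    {ffun 'I_N -> A} :=
  [ffun i => if i == n then b else a i].

(* V(n:f), where f is defined on V only *)
Definition updf (A : Type) (N : nat) (V : set {ffun 'I_N -> A}) (n : 'I_N)
    (f : V -> A) : set {ffun 'I_N -> A} :=
  range (fun a : V => upd (val a) n (f a)).

(* V(n:A) *)
Definition cylindrify (A : Type) (N : nat) (V : set {ffun 'I_N -> A})
    (n : 'I_N) : set {ffun 'I_N -> A} :=
  [set c | exists a b, V a /\ c = upd a n b].

Section Semantics.
Variables (L : language) (A : structure L) (N : nat).
Local Notation val_ := {ffun 'I_N -> A}.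

Fixpoint eval (a : val_) (t : term L N) : A :=
  match t with
  | Var i => a i
  | App f ts => fint [ffun i => eval a (ts i)]
  end.

Definition sat_atom (a : val_) (p : atom L N) : Prop :=
  match p with
  | Eq t u => eval a t = eval a u
  | Rel r ts => rint [ffun i => eval a (ts i)]
  end.

Fixpoint sat (a : val_) (p : formula L N) : Prop :=
  match p with
  | Atom p => sat_atom a p
  | Top => True
  | Bot => False
  | Not p => ~ sat a p
  | And p q => sat a p /\ sat a q
  | Or p q => sat a p \/ sat a q
  | Imp p q => sat a p -> sat a q
  | Exists n p => exists b, sat (upd a n b) p
  | Forall n p => forall b, sat (upd a n b) p
  end.

Definition fo_meaning (p : formula L N) : set val_ := [set a | sat a p].

End Semantics.

Arguments fo_meaning {L} A {N} p.

(* Algebras in the common signature <0, 1, D_ij, -, +, ., C_n>; the unary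
   operation [aneg] is complement in one algebra and X^cup in the other. *)
Record algebra (N : nat) := Algebra {
  car :> Type;
  azero : car;
  aone : car;
  adiag : 'I_N -> 'I_N -> car;
  aneg : car -> car;
  aadd : car -> car -> car;
  amul : car -> car -> car;
  acyl : 'I_N -> car -> car
}.

Arguments azero {N a}.
Arguments aone {N a}.
Arguments adiag {N a}.

Definition homomorphism (N : nat) (X Y : algebra N) (h : X -> Y) : Prop :=
  [/\ h azero = azero /\ h aone = aone,
      forall i j, h (adiag i j) = adiag i j,
      forall x, h (aneg x) = aneg (h x),
      (forall x y, h (aadd x y) = aadd (h x) (h y)) /\
      (forall x y, h (amul x y) = amul (h x) (h y)) &
      forall n x, h (acyl n x) = acyl n (h x)].

Definition isomorphic (N : nat) (X Y : algebra N) : Prop :=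
  exists h : X -> Y, bijective h /\ homomorphism h.

Record subuniverse (N : nat) (X : algebra N) (S : set X) : Prop := Subuniverse {
  sub_zero : S azero;
  sub_one : S aone;
  sub_diag : forall i j, S (adiag i j);
  sub_neg : forall x, S x -> S (aneg x);
  sub_add : forall x y, S x -> S y -> S (aadd x y);
  sub_mul : forall x y, S x -> S y -> S (amul x y);
  sub_cyl : forall n x, S x -> S (acyl n x)
}.

Definition subalgebra (N : nat) (X : algebra N) (S : set X)
    (HS : subuniverse S) : algebra N :=
  let v (x : S) : S (val x) := set_mem (valP x) in
  @Algebra N S
    (SigSub (mem_set (sub_zero HS)))
    (SigSub (mem_set (sub_one HS)))
    (fun i j => SigSub (mem_set (sub_diag HS i j)))
    (fun x => SigSub (mem_set (sub_neg HS (v x))))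
    (fun x y => SigSub (mem_set (sub_add HS (v x) (v y))))
    (fun x y => SigSub (mem_set (sub_mul HS (v x) (v y))))
    (fun n x => SigSub (mem_set (sub_cyl HS n (v x)))).

Lemma smallest_subuniverse (N : nat) (X : algebra N) (G : set X) :
  subuniverse (smallest (@subuniverse N X) G).
Proof.
split=> [||i j|x Sx|x y Sx Sy|x y Sx Sy|n x Sx] M /= [] HM GM.
- exact: sub_zero.
- exact: sub_one.
- exact: sub_diag.
- by apply: sub_neg => //; apply: Sx.
- by apply: sub_add => //; [apply: Sx | apply: Sy].
- by apply: sub_mul => //; [apply: Sx | apply: Sy].
- by apply: sub_cyl => //; apply: Sx.
Qed.

Definition generated (N : nat) (X : algebra N) (G : set X) : algebra N :=
  subalgebra (smallest_subuniverse G).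

Definition set_algebra (A : Type) (N : nat) : algebra N :=
  @Algebra N (set {ffun 'I_N -> A})
    set0
    setT
    (fun i j => [set a : {ffun 'I_N -> A} | a i = a j])
    (fun V => ~` V)
    (fun V W => V `|` W)
    (fun V W => V `&` W)
    (fun n V => cylindrify V n).

Lemma fo_subuniverse (L : language) (A : structure L) (N : nat) :
  subuniverse (range (@fo_meaning L A N) : set (set_algebra A N)).
Proof.
split=> [||i j|_ [p _ <-]|_ _ [p _ <-] [q _ <-]|_ _ [p _ <-] [q _ <-]
        |n _ [p _ <-]] /=.
- by exists Bot.
- by exists Top.
- by exists (Atom (Eq (Var L i) (Var L j))).
- by exists (Not p).
- by exists (Or p q).
- by exists (And p q).
- exists (Exists n p) => //; apply/seteqP; split=> a /= [b].
    move=> pb; exists (upd a n b), (a n); split=> //.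
    by apply/ffunP => i; rewrite !ffunE; case: eqP => // ->.
  case=> c [pb ->]; exists (b n).
  suff -> : upd (upd b n c) n (b n) = b by [].
  by apply/ffunP => i; rewrite !ffunE; case: eqP => // ->.
Qed.

Definition Cs (L : language) (A : structure L) (N : nat) : algebra N :=
  subalgebra (@fo_subuniverse L A N).

Definition power (T : Type) (V : set T) : set (set T) := [set W | W `<=` V].

Definition disjoint_unions (T : Type) (F G : set (set T)) : set (set T) :=
  [set V | exists V1 V2, [/\ F V1, G V2, V1 `&` V2 = set0 & V = V1 `|` V2]].

(* A pair X = <X^+, X^-> is represented by (X.1, X.2). *)
Definition ifg_pair_algebra (A : Type) (N : nat) : algebra N :=
  let T := {ffun 'I_N -> A} in
  @Algebra N (set (set T) * set (set T))
    ([set set0], setT)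
    (setT, [set set0])
    (fun i j => (power [set a : T | a i = a j], power [set a : T | a i <> a j]))
    (fun X => (X.2, X.1))
    (fun X Y => (disjoint_unions X.1 Y.1, X.2 `&` Y.2))
    (fun X Y => (X.1 `&` Y.1, disjoint_unions X.2 Y.2))
    (fun n X => ([set V : set T | exists f : V -> A, X.1 (updf n f)],
                 [set W : set T | X.2 (cylindrify W n)])).

Definition ifg_atom_meaning (L : language) (A : structure L) (N : nat)
    (p : atom L N) : ifg_pair_algebra A N :=
  ([set V | forall a : {ffun 'I_N -> A}, V a -> sat_atom a p],
   [set W | forall b : {ffun 'I_N -> A}, W b -> ~ sat_atom b p]).

Definition Cs_IFG (L : language) (A : structure L) (N : nat) : algebra N :=
  generated (range (@ifg_atom_meaning L A N)).

(* Main.v *)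
(** A set [V] of valuations is encoded by the pair of power sets
    [(power V, power (~` V))]. This encoding is an injective homomorphism from
    the full cylindric set algebra to the algebra of pairs, and it sends the
    extension of an atomic formula to its IFG meaning. As formula extensions
    are generated by the extensions of atoms, the encoding restricts to an
    isomorphism between the two generated subalgebras. *)
Require Import Defs.
From mathcomp Require Import all_boot.
From mathcomp Require Import boolp classical_sets.

Set Implicit Arguments.
Unset Strict Implicit.
Unset Printing Implicit Defensive.

Local Open Scope classical_set_scope.

Lemma subalgebra_isomorphic (N : nat) (X Y : algebra N) (h : X -> Y)
    (S : set X) (T : set Y) (HS : subuniverse S) (HT : subuniverse T) :
  homomorphism h -> injective h -> h @` S = T ->
  isomorphic (subalgebra HS) (subalgebra HT).
Proof.
move=> [[h0 h1] hd hn [ha hm] hc] hinj hST.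
have hT (x : S) : T (h (val x)).
  by rewrite -hST; exists (val x) => //; apply: set_mem (valP x).
have hsurj (y : T) : exists x : S, h (val x) = val y.
  have: T (val y) := set_mem (valP y).
  by rewrite -{1}hST => -[x Sx <-]; exists (SigSub (mem_set Sx)).
(* Chosen preimages give a right inverse; injectivity of [h] makes it two-sided. *)
have [g gK] := choice hsurj.
exists (fun x : S => SigSub (mem_set (hT x))); split.
  exists g => [x|y]; apply: val_inj; last exact: gK.
  by apply: hinj; rewrite gK.
by split; [split|move=> i j|move=> x|split=> x y|move=> n x];
  apply: val_inj => /=.
Qed.

(** A homomorphism pulls subuniverses back to subuniverses and pushes them forward to subuniverses;
    each fact yields one inclusion. *)
Lemma image_smallest_subuniverse (N : nat) (X Y : algebra N) (h : X -> Y)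
    (G : set X) :
  homomorphism h ->
  h @` smallest (@subuniverse N X) G = smallest (@subuniverse N Y) (h @` G).
Proof.
move=> [[h0 h1] hd hn [ha hm] hc].
have HG := smallest_subuniverse G.
apply/seteqP; split.
- move=> _ [x Gx <-] M [HM GM]; apply: (Gx (h @^-1` M)); split.
    split=> [||i j|y My|y z My Mz|y z My Mz|n y My].
    + by rewrite /preimage /= h0; apply: sub_zero.
    + by rewrite /preimage /= h1; apply: sub_one.
    + by rewrite /preimage /= hd; apply: sub_diag.
    + by rewrite /preimage /= hn; apply: sub_neg.
    + by rewrite /preimage /= ha; apply: sub_add.
    + by rewrite /preimage /= hm; apply: sub_mul.
    + by rewrite /preimage /= hc; apply: sub_cyl.
  by move=> y Gy; apply: GM; exists y.
- apply: smallest_sub; last first.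
    by move=> _ [x Gx <-]; exists x => // M [_]; apply.
  split=> [||i j|_ [x Gx <-]|_ _ [x Gx <-] [y Gy <-]
          |_ _ [x Gx <-] [y Gy <-]|n _ [x Gx <-]].
  + by exists azero => //; apply: (sub_zero HG).
  + by exists aone => //; apply: (sub_one HG).
  + by exists (adiag i j) => //; apply: (sub_diag HG).
  + by exists (aneg x) => //; apply: (sub_neg HG).
  + by exists (aadd x y) => //; apply: (sub_add HG).
  + by exists (amul x y) => //; apply: (sub_mul HG).
  + by exists (acyl n x) => //; apply: (sub_cyl HG).
Qed.

Section Encoding.
Variables (A : Type) (N : nat).
Local Notation T := {ffun 'I_N -> A}.

Lemma upd_upd (a : T) (n : 'I_N) (b c : A) : upd (upd a n b) n c = upd a n c.
Proof. by apply/ffunP => i; rewrite !ffunE; case: eqP. Qed.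

Lemma upd_id (a : T) (n : 'I_N) : upd a n (a n) = a.
Proof. by apply/ffunP => i; rewrite ffunE; case: eqP => // ->. Qed.

(** This form matches the semantics of [Exists] and exposes the witness that a choice function
    needs. *)
Lemma cylindrifyE (V : set T) (n : 'I_N) :
  cylindrify V n = [set a | exists b, V (upd a n b)].
Proof.
apply/seteqP; split=> a /=.
  by move=> [c [b [Vc ->]]]; exists (c n); rewrite upd_upd upd_id.
by move=> [b Vb]; exists (upd a n b), (a n); rewrite upd_upd upd_id.
Qed.

Lemma power0 (U : Type) : power (@set0 U) = [set set0].
Proof. by apply/seteqP; split=> V /=; rewrite /power /= subset0. Qed.

Lemma powerT (U : Type) : power (@setT U) = setT.
Proof. by apply/seteqP; split. Qed.

Lemma power_setI (U : Type) (V W : set U) :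
  power (V `&` W) = power V `&` power W.
Proof. by apply/seteqP; split=> Z /=; rewrite /power /= subsetI. Qed.

(** Any [Z] inside the union splits into the disjoint pieces inside [V] and outside [V], so on power
    sets the disjointness demand in the sum and product of pairs costs nothing. *)
Lemma power_setU (U : Type) (V W : set U) :
  power (V `|` W) = disjoint_unions (power V) (power W).
Proof.
apply/seteqP; split=> Z.
  move=> ZVW; exists (Z `&` V), (Z `\` V); split.
  - exact: subIsetr.
  - by move=> a [/ZVW[]].
  - by rewrite setDE setIACA setICr setI0.
  - by rewrite setUIDK.
by move=> [Z1 [Z2 [ZV ZW _ ->]]]; apply: setUSS.
Qed.

(** The axiom of choice turns pointwise witnesses for coordinate [n] into a single function on
    [V]. *)
Lemma updf_sub (V W : set T) (n : 'I_N) :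
  (exists f : V -> A, updf n f `<=` W) <-> V `<=` cylindrify W n.
Proof.
rewrite cylindrifyE; split=> [[f fW] a Va|VW].
  exists (f (SigSub (mem_set Va))); apply: fW.
  by exists (SigSub (mem_set Va)).
have /choice[f fW] (a : V) : exists b, W (upd (val a) n b).
  exact: VW (set_mem (valP a)).
by exists f => _ [a _ <-].
Qed.

(** Both sides say that no point of [V] agrees with a point of [W] off coordinate [n], a symmetric
    condition. *)
Lemma cylindrify_subC (V W : set T) (n : 'I_N) :
  cylindrify W n `<=` ~` V <-> W `<=` ~` cylindrify V n.
Proof.
rewrite [cylindrify V n]cylindrifyE; split.
  by move=> WV a Wa [b Vb]; apply: WV Vb; exists a, b.
by move=> WV _ [a [b [Wa ->]]] Vb; apply: (WV a Wa); exists b.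
Qed.

Definition flat_pair (V : set_algebra A N) : ifg_pair_algebra A N :=
  (power V, power (~` V)).

Lemma flat_pair_inj : injective flat_pair.
Proof.
move=> V W [eqVW _]; apply/seteqP; split.
  by have: power W V by rewrite -eqVW.
by have: power V W by rewrite eqVW.
Qed.

Lemma flat_pair_hom : homomorphism flat_pair.
Proof.
rewrite /flat_pair; split=> [|i j|V|/=|n V] //=.
- by rewrite setC0 setCT power0 powerT.
- by rewrite setCK.
- by split=> V W; rewrite ?setCU ?setCI !(power_setU, power_setI).
(* The positive halves agree by choice, the negative halves by the symmetry of cylindrification. *)
- congr pair; apply/seteqP; split=> W; rewrite /power /=.
  + by move/updf_sub.
  + by move/updf_sub.
  + by move/cylindrify_subC.
  + by move/cylindrify_subC.
Qed.

End Encoding.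

(** Induction on formulas: each connective is an algebra operation, except [Imp] and [Forall], which
    reduce classically to [Not], [Or] and [Exists]. *)
Lemma fo_meaning_generated (L : language) (A : structure L) (N : nat) :
  (range (@fo_meaning L A N) : set (set_algebra A N)) =
  smallest (@subuniverse N (set_algebra A N))
    (range (fun p : atom L N => fo_meaning A (Atom p))).
Proof.
apply/seteqP; split; last first.
  apply: smallest_sub; first exact: fo_subuniverse.
  by move=> _ [p _ <-]; exists (Atom p).
move=> _ [p _ <-] M [HM GM].
have neg q : M (fo_meaning A q) -> M (fo_meaning A (Not q)).
  exact: (sub_neg HM).
have ex n q : M (fo_meaning A q) -> M (fo_meaning A (Exists n q)).
  by move=> /(sub_cyl HM n) /=; rewrite cylindrifyE.
elim: p => [p| | |p|p Mp q Mq|p Mp q Mq|p Mp q Mq|n p|n p Mp].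
- by apply: GM; exists p.
- exact: (sub_one HM).
- exact: (sub_zero HM).
- exact: neg.
- exact: (sub_mul HM Mp Mq).
- exact: (sub_add HM Mp Mq).
- suff -> : fo_meaning A (Imp p q) = fo_meaning A (Or (Not p) q).
    exact: (sub_add HM (neg _ Mp) Mq).
  by apply/predeqP => a; rewrite /fo_meaning /= implyE.
- exact: ex.
- suff -> : fo_meaning A (Forall n p) = fo_meaning A (Not (Exists n (Not p))).
    by apply/neg/ex/neg.
  apply/seteqP; split=> a /=.
    by move=> pa [b]; apply; apply: pa.
  by move=> npa b; apply: contrapT => npb; apply: npa; exists b.
Qed.

Theorem theorem3p8 (L : language) (A : structure L) (N : nat) :
  isomorphic (Cs A N) (Cs_IFG A N).
Proof.
apply: (subalgebra_isomorphic _ _ (@flat_pair_hom A N) (@flat_pair_inj A N)).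
(* Both universes become generated sets, so only generators remain to be compared; [flat_pair] sends
   the extension of an atom to its IFG meaning by mere unfolding. *)
rewrite fo_meaning_generated
  (image_smallest_subuniverse _ (@flat_pair_hom A N)).
by rewrite image_comp.
Qed.
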